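(* Let $(X,Y,A,f,h)$ satisfy the standing assumptions in the context. Suppose $\gamma>1$ is such that $f\circ A$ has $\gamma$-curvature relative to $h$ with constant $C$ and $h^*\circ A^*$ has $\gamma$-curvature relative to $\tilde f^*$ with constant $C^*$ (both defined in the context), where $\tilde f(y)=f(-y)$. Let $(x_k,u_k,s_k,z_k)$, $k=0,1,2,\dots$, be the iterates generated by the primal-dual hybrid algorithm for $\min_{x\in X}\{f(Ax)+h(x)\}$ (defined in the context), where $\alpha_0=1$ and for $k=1,2,\dots$ the step size $\alpha_k\in[0,1]$ is chosen by the line search $$\alpha_k\in\operatorname*{argmin}_{\alpha\in[0,1]}\bigl\{(1-\alpha)\,H_k+D_f(A(x_k+\alpha(s_k-x_k)),Ax_k)+D_{h^*}(-A^*(u_k+\alpha(z_k-u_k)),-A^*u_k)\bigr\},$$ with $H_1=D_f(As_0,Ax_0)+D_{h^*}(-A^*z_0,-A^*u_0)$ and, for $k=1,2,\dots$, $$H_{k+1}=(1-\alpha_k)H_k+D_f(A((1-\alpha_k)x_k+\alpha_ks_k),Ax_k)+D_{h^*}(-A^*((1-\alpha_k)u_k+\alpha_kz_k),-A^*u_k).$$ Then for all $k=1,2,\dots$ $$f(Ax_k)+h(x_k)+f^*(u_k)+h^*(-A^*u_k)\le(C+C^* )\left(\frac{\gamma}{k+\gamma}\right)^{\gamma-1}.$$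
   Context: Setting. $X,Y$ are finite-dimensional real vector spaces with duals $X^*,Y^*$ and pairings $\langle\cdot,\cdot\rangle$; $A:X\to Y$ is linear with adjoint $A^*:Y^*\to X^*$; $f:Y\to\mathbb{R}\cup\{\infty\}$ and $h:X\to\mathbb{R}\cup\{\infty\}$ are proper closed convex functions with Fenchel conjugates $f^*:Y^*\to\mathbb{R}\cup\{\infty\}$, $h^*:X^*\to\mathbb{R}\cup\{\infty\}$. $\operatorname{dom}(\partial f)\subseteq Y$ and $\operatorname{dom}(\partial h^* )\subseteq X^*$ are the sets of points at which the respective subdifferential is nonempty. Single-valued oracles are fixed: for each $y\in\operatorname{dom}(\partial f)$, $\partial f(y)\in Y^*$ denotes one fixed chosen element of $\operatorname{argmax}_{v\in Y^*}\{\langle v,y\rangle-f^*(v)\}$ (the subdifferential of $f$ at $y$); for each $u\in\operatorname{dom}(\partial h^* )$, $\partial h^*(u)\in X$ denotes one fixed chosen element of $\operatorname{argmax}_{x\in X}\{\langle u,x\rangle-h(x)\}$ (the subdifferential of $h^*$ at $u$). Standing assumption: $-A^*\partial f(y)\in\operatorname{dom}(\partial h^* )$ for all $y\in\operatorname{dom}(\partial f)$, and $A\,\partial h^*(u)\in\operatorname{dom}(\partial f)$ for all $u\in\operatorname{dom}(\partial h^* )$. Generalized Bregman distances: $D_f(y,w)=f(y)-f(w)-\langle\partial f(w),y-w\rangle$ for $w\in\operatorname{dom}(\partial f)$, $y\in\operatorname{dom}(f)$, and $D_{h^*}(v,u)=h^*(v)-h^*(u)-\langle v-u,\partial h^*(u)\rangle$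 for $u\in\operatorname{dom}(\partial h^* )$, $v\in\operatorname{dom}(h^* )$, with the chosen subgradients. Relative $\gamma$-curvature: $f\circ A$ has $\gamma$-curvature relative to $h$ with (finite) constant $C$ if for all $x\in X$ with $Ax\in\operatorname{dom}(\partial f)$ and all $v\in\operatorname{dom}(\partial h^* )$, with $s=\partial h^*(v)$, one has $D_f(A(x+\alpha(s-x)),Ax)\le C\alpha^\gamma/\gamma$ for all $\alpha\in[0,1]$. Correspondingly (with subgradient oracle $\partial\tilde f(w)=-\partial f(-w)$ for $\tilde f^{**}=\tilde f$), $h^*\circ A^*$ has $\gamma$-curvature relative to $\tilde f^*$ with (finite) constant $C^*$ if for all $v\in Y^*$ with $A^*v\in\operatorname{dom}(\partial h^* )$ and all $y\in\operatorname{dom}(\partial f)$, with $z=\partial f(y)$, one has $D_{h^*}(A^*(v+\alpha(-z-v)),A^*v)\le C^*\alpha^\gamma/\gamma$ for all $\alpha\in[0,1]$. Primal-dual hybrid algorithm: given $x_0\in X$ with $Ax_0\in\operatorname{dom}(\partial f)$ and $u_0\in Y^*$ with $-A^*u_0\in\operatorname{dom}(\partial h^* )$, for $k=0,1,2,\dots$: $(s_k,z_k):=(\partial h^*(-A^*u_k),\partial f(Ax_k))$, pick $\alpha_k\in[0,1]$, $(x_{k+1},u_{k+1}):=(1-\alpha_k)(x_k,u_k)+\alpha_k(s_k,z_k)$. The iterates are understood to be well defined, i.e. $Ax_k\in\operatorname{dom}(\partial f)$ and $-A^*u_k\in\operatorname{dom}(\partial h^* )$ for all $k$. *)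

(* Defs.v *)
From HB Require Import structures.
From mathcomp Require Import all_boot all_order all_algebra.
From mathcomp Require Import all_classical all_reals all_analysis.

Set Implicit Arguments.
Unset Strict Implicit.
Unset Printing Implicit Defensive.

Import Order.TTheory GRing.Theory Num.Theory.
Import numFieldNormedType.Exports.

Local Open Scope classical_set_scope.
Local Open Scope ring_scope.

(* The dual V^* of V : vectType R is 'Hom(V, R^o) (again a vectType), and the
   pairing <v, y> is the application v y; the bidual of V is identified with V,
   so a subgradient of a function on V^* is an element of V. *)

Section convex_functions.
Local Open Scope ereal_scope.
Context {R : realType} {V : vectType R}.

Definition argmax {T : Type} (g : T -> \bar R) : set T :=
  [set t | forall t', g t' <= g t].

Definition argmin_on {T : Type} (S : set T) (g : T -> \bar R) : set T :=
  [set t | S t /\ forall t', S t' -> g t <= g t'].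

Definition epigraph (g : V -> \bar R) : set (V * R^o) :=
  [set p | g p.1 <= (p.2 : R)%:E].

Definition proper (g : V -> \bar R) : Prop :=
  (forall x, g x != -oo) /\ (exists x, g x < +oo).

Definition convex_fun (g : V -> \bar R) : Prop :=
  @convex_set R (V * R^o)%type (epigraph g).

(* A vectType carries no topology, so the epigraph is read in the coordinates
   of a basis of V; on a finite-dimensional space the result does not depend on
   the basis. *)
Definition closed_fun (g : V -> \bar R) : Prop :=
  closed [set p : 'rV[R]_(\dim {:V}) * R |
    epigraph g (\sum_i p.1 ord0 i *: (vbasis {:V})`_i, p.2)%R].

Definition proper_closed_convex (g : V -> \bar R) : Prop :=
  [/\ proper g, closed_fun g & convex_fun g].

Definition conjugate (g : V -> \bar R) (v : 'Hom(V, R^o)) : \bar R :=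
  ereal_sup (range (fun x : V => (v x : R)%:E - g x)).

Definition subdiff (g : V -> \bar R) (y : V) : set 'Hom(V, R^o) :=
  argmax (fun v : 'Hom(V, R^o) => (v y : R)%:E - conjugate g v).

Definition subdiff_conj (g : V -> \bar R) (u : 'Hom(V, R^o)) : set V :=
  argmax (fun x : V => (u x : R)%:E - g x).

Definition dom_subdiff (g : V -> \bar R) : set V :=
  [set y | subdiff g y !=set0].

Definition dom_subdiff_conj (g : V -> \bar R) : set 'Hom(V, R^o) :=
  [set u | subdiff_conj g u !=set0].

(* Oracles are total functions whose values outside the domain of the
   subdifferential are irrelevant. *)
Definition subdiff_oracle (g : V -> \bar R) (dg : V -> 'Hom(V, R^o)) : Prop :=
  forall y, dom_subdiff g y -> subdiff g y (dg y).

Definition subdiff_conj_oracle (g : V -> \bar R) (dgs : 'Hom(V, R^o) -> V)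
  : Prop :=
  forall u, dom_subdiff_conj g u -> subdiff_conj g u (dgs u).

Definition bregman (g : V -> \bar R) (dg : V -> 'Hom(V, R^o)) (y w : V)
  : \bar R :=
  g y - g w - (dg w (y - w)%R : R)%:E.

Definition bregman_conj (g : V -> \bar R) (dgs : 'Hom(V, R^o) -> V)
    (v u : 'Hom(V, R^o)) : \bar R :=
  conjugate g v - conjugate g u - ((v - u)%R (dgs u) : R)%:E.

End convex_functions.

Section composite_problem.
Context {R : realType} {X Y : vectType R}.
Variables (A : 'Hom(X, Y)) (f : Y -> \bar R) (h : X -> \bar R).
Variables (df : Y -> 'Hom(Y, R^o)) (dhs : 'Hom(X, R^o) -> X).

Definition adjoint (v : 'Hom(Y, R^o)) : 'Hom(X, R^o) := (v \o A)%VF.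

Definition oracles_compatible : Prop :=
  (forall y, dom_subdiff f y -> dom_subdiff_conj h (- adjoint (df y))) /\
  (forall u, dom_subdiff_conj h u -> dom_subdiff f (A (dhs u))).

(* gamma-curvature of f \o A relative to h. *)
Definition relative_curvature (gamma C : R) : Prop :=
  forall (x : X) (v : 'Hom(X, R^o)),
    dom_subdiff f (A x) -> dom_subdiff_conj h v ->
    forall alpha : R, 0 <= alpha <= 1 ->
      (bregman f df (A (x + alpha *: (dhs v - x))%R) (A x)
       <= (C * alpha `^ gamma / gamma)%:E)%E.

(* gamma-curvature of h^* \o A^* relative to ft^*, where ft y := f (- y): the
   subgradient oracle of ft = ft^** at w is - df (- w), here with w = - y. *)
Definition relative_curvature_conj (gamma Cs : R) : Prop :=
  forall (v : 'Hom(Y, R^o)) (y : Y),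
    dom_subdiff_conj h (adjoint v) -> dom_subdiff f y ->
    forall alpha : R, 0 <= alpha <= 1 ->
      (bregman_conj h dhs (adjoint (v + alpha *: (- df y - v))%R) (adjoint v)
       <= (Cs * alpha `^ gamma / gamma)%:E)%E.

Definition primal_dual_hybrid (x : nat -> X) (u : nat -> 'Hom(Y, R^o))
    (s : nat -> X) (z : nat -> 'Hom(Y, R^o)) (alpha : nat -> R) : Prop :=
  forall k : nat,
    [/\ dom_subdiff f (A (x k)) /\ dom_subdiff_conj h (- adjoint (u k)),
        s k = dhs (- adjoint (u k)) /\ z k = df (A (x k)),
        0 <= alpha k <= 1,
        x k.+1 = (1 - alpha k) *: x k + alpha k *: s k &
        u k.+1 = (1 - alpha k) *: u k + alpha k *: z k].

Definition line_search_objective (Hk : \bar R) (xk sk : X)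
    (uk zk : 'Hom(Y, R^o)) (alpha : R) : \bar R :=
  ((1 - alpha)%:E * Hk
   + bregman f df (A (xk + alpha *: (sk - xk))%R) (A xk)
   + bregman_conj h dhs (- adjoint (uk + alpha *: (zk - uk)))%R
       (- adjoint uk)%R)%E.

(* H 0 is unconstrained. *)
Definition line_search_bounds (x : nat -> X) (u : nat -> 'Hom(Y, R^o))
    (s : nat -> X) (z : nat -> 'Hom(Y, R^o)) (alpha : nat -> R)
    (H : nat -> \bar R) : Prop :=
  (H 1%N = bregman f df (A (s 0%N)) (A (x 0%N))
           + bregman_conj h dhs (- adjoint (z 0%N))%R (- adjoint (u 0%N))%R)%E
  /\
  forall k : nat, (1 <= k)%N ->
    (H k.+1 = (1 - alpha k)%:E * H k
      + bregman f df (A ((1 - alpha k) *: x k + alpha k *: s k)%R) (A (x k))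
      + bregman_conj h dhs
          (- adjoint ((1 - alpha k) *: u k + alpha k *: z k))%R
          (- adjoint (u k))%R)%E.

End composite_problem.

(* Main.v *)
(* The heart is the duality-gap recursion
     gap_{k+1} <= (1 - alpha_k) gap_k + D_f(A x_{k+1}, A x_k)
                  + D_{h^*}(- A^* u_{k+1}, - A^* u_k),
   obtained by expanding f and h^* around the current iterates, using convexity
   of h and f^*, and cancelling with the Fenchel equalities at (A x_k, z_k) and
   (s_k, - A^* u_k).  Hence gap_k <= H_k, and the line search together with
   the curvature bounds gives
     H_{k+1} <= (1 - a) H_k + (C + C^* ) a^gamma / gamma  for all a in [0, 1].
   The choice a = gamma / (k + gamma) yields the rate by induction.

   As the subdifferential of f is an argmax over the dual space, the equality
   f(y) + f^*(z) = <z, y> rests on the Fenchel-Moreau theorem; it is derived by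
   projecting a point below the graph onto the closed convex epigraph. *)

Require Import Defs.
From HB Require Import structures.
From mathcomp Require Import all_boot all_order all_algebra.
From mathcomp Require Import all_classical all_reals all_analysis.
From mathcomp Require Import ring lra.

Import Order.TTheory GRing.Theory Num.Theory.
Import numFieldNormedType.Exports.

Local Open Scope classical_set_scope.
Local Open Scope ring_scope.

(** * Euclidean structure on a finite-dimensional space *)

Section dot_product.
Context {R : realType} {V : vectType R}.
Implicit Types v w : V.

Local Notation crd i := (coord (vbasis {:V}) i).

(* The inner product for which [vbasis {:V}] is orthonormal. *)
Definition dotv v : 'Hom(V, R^o) :=
  \sum_(i < \dim {:V}) (crd i v : R) *: linfun (crd i : V -> R^o).

Lemma dotvE v w : dotv v w = \sum_(i < \dim {:V}) crd i v * crd i w :> R.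
Proof.
by rewrite /dotv sum_lfunE; apply: eq_bigr => i _; rewrite scale_lfunE lfunE.
Qed.

Lemma dotvC v w : dotv v w = dotv w v.
Proof. by rewrite !dotvE; apply: eq_bigr => i _; rewrite mulrC. Qed.

Lemma dotvv_ge0 v : 0 <= (dotv v v : R).
Proof. by rewrite dotvE sumr_ge0 // => i _; rewrite -expr2 sqr_ge0. Qed.

Lemma dotvv_eq0 v : dotv v v = 0 -> v = 0.
Proof.
rewrite dotvE => /psumr_eq0P vv0.
rewrite (coord_vbasis (memvf v)) big1 // => i _.
suff -> : crd i v = 0 by rewrite scale0r.
apply/eqP; rewrite -sqrf_eq0 expr2; apply/eqP/vv0 => // j _.
by rewrite -expr2 sqr_ge0.
Qed.

Lemma dotv_line v w (a : R) :
  dotv (v + a *: w) (v + a *: w) =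
  dotv v v + (dotv v w * a *+ 2 + a ^+ 2 * dotv w w) :> R.
Proof.
rewrite linearD linearZ /= dotvC linearD linearZ /= dotvC.
rewrite (dotvC (_ + _) w) linearD linearZ /= (dotvC w v) /GRing.scale /=.
ring.
Qed.

End dot_product.

(** * Projection onto a closed convex epigraph *)

Lemma ge0_linear_of_quadratic (R : realFieldType) (b c : R) :
  (forall a, 0 < a <= 1 -> 0 <= b * a *+ 2 + a ^+ 2 * c) -> 0 <= b.
Proof.
move=> bc; rewrite leNgt; apply/negP => b0.
have d0 : 0 < `|c| - b by have := normr_ge0 c; lra.
(* Here [a * (|c| - b) = - b], so the bracket [2 b + a c] left after factoring out [a] is at most
   [b < 0]. *)
pose a := - b / (`|c| - b).
have a0 : 0 < a by rewrite divr_gt0 // oppr_gt0.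
have a1 : a <= 1 by rewrite ler_pdivrMr // mul1r lerDr.
have := bc a; rewrite a0 a1 => /(_ isT).
have -> : b * a *+ 2 + a ^+ 2 * c = a * (b *+ 2 + a * c) by ring.
rewrite pmulr_rge0 // leNgt => /negP; apply.
have : a * c <= a * `|c| by rewrite ler_pM2l // ler_norm.
have : a * `|c| <= a * (`|c| - b) by rewrite ler_pM2l // lerDl; lra.
by rewrite /a divfK ?gt_eqF //; lra.
Qed.

Definition sqdist {R : realType} {V : vectType R} (p q : V * R^o) : R :=
  (dotv (q.1 - p.1) (q.1 - p.1) : R) + ((q.2 : R) - p.2) ^+ 2.

Section projection.
Context {R : realType} {V : vectType R}.
Implicit Types (g : V -> \bar R) (p q e : V * R^o).

Local Notation n := (\dim {:V}).
Local Notation crd i := (coord (vbasis {:V}) i).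

(** The parametrization used in [closed_fun]: compactness and continuity are argued on the
    coordinate side. *)
Let point (c : 'rV[R]_n * R) : V * R^o :=
  (\sum_i c.1 ord0 i *: (vbasis {:V})`_i, c.2).

Let coords (p : V * R^o) : 'rV[R]_n * R := (\row_i crd i p.1, p.2).

Let coordsK p : point (coords p) = p.
Proof.
rewrite /point /coords [RHS]surjective_pairing; congr pair.
rewrite [RHS](coord_vbasis (memvf _)).
by apply: eq_bigr => i _ /=; rewrite mxE.
Qed.

Let crd_point c i : crd i (point c).1 = c.1 ord0 i.
Proof. by rewrite /point /= coord_sum_free // (basis_free (vbasisP _)). Qed.

Let sqdist_point p c : sqdist p (point c) =
  \sum_i (c.1 ord0 i - crd i p.1) ^+ 2 + (c.2 - p.2) ^+ 2.
Proof.
rewrite /sqdist dotvE; congr +%R; apply: eq_bigr => i _.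
by rewrite linearB /= crd_point expr2.
Qed.

Let sqdist_continuous p : continuous (fun c => sqdist p (point c)).
Proof.
have sq (F : 'rV[R]_n * R -> R) (a : R) :
    continuous F -> continuous (fun c => (F c - a) ^+ 2).
  move=> cF c; rewrite -/(GRing.exp _ 2).
  under eq_fun do rewrite expr2.
  by apply: cvgM; apply: cvgB; [exact: cF|exact: cvg_cst|exact: cF|exact: cvg_cst].
under eq_fun do rewrite sqdist_point.
move=> c; apply: cvgD; last by apply: sq => ?; exact: cvg_snd.
apply: (@continuous_big R _ +%R 0 xpredT) => [|i _]; first exact: add_continuous.
apply: (sq (fun c => c.1 ord0 i)) => q.
apply: (@continuous_comp _ _ _ fst (fun M : 'rV[R]_n => M ord0 i)).
  exact: cvg_fst.
exact: coord_continuous.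
Qed.

(** The distance attains its minimum on the compact part of the epigraph inside a box around [p].
    Points outside the box are farther from [p] than [e0], which is inside. *)
Lemma closest_point_epigraph g p : closed_fun g -> epigraph g !=set0 ->
  exists2 q, epigraph g q & forall e, epigraph g e -> sqdist p q <= sqdist p e.
Proof.
move=> gcl [e0 ge0].
(* The added 1 gives [1 <= M], so a square bounded by [M] has a root bounded by [M]. *)
pose M := sqdist p e0 + 1.
pose box := [set v : 'rV[R]_n | forall i, `[crd i p.1 - M, crd i p.1 + M]%classic
                                          (v ord0 i)]
            `*` `[p.2 - M, p.2 + M]%classic.
have box_compact : compact box.
  apply: compact_setX; last exact: segment_compact.
  apply: (@rV_compact _ _ (fun i => `[crd i p.1 - M, crd i p.1 + M]%classic)) => i.
  exact: segment_compact.
have in_box e : sqdist p e <= sqdist p e0 -> box (coords e).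
  rewrite -[e in X in X -> _]coordsK sqdist_point => le_e0.
  have sum0 (P : pred 'I_n) :
      0 <= \sum_(i | P i) ((coords e).1 ord0 i - crd i p.1) ^+ 2.
    by apply: sumr_ge0 => i _; rewrite sqr_ge0.
  have M1 : 1 <= M.
    rewrite /M lerDr -[e0]coordsK sqdist_point addr_ge0 ?sqr_ge0 //.
    by apply: sumr_ge0 => i _; rewrite sqr_ge0.
  have near (a b : R) : (a - b) ^+ 2 <= M -> b - M <= a <= b + M.
    move=> abM; apply/andP; split; rewrite leNgt; apply/negP => ?; nra.
  split=> [i|] /=; rewrite in_itv /=; apply: near; rewrite /M.
    move: le_e0; rewrite (bigD1 i) //=.
    have := sum0 (fun j => j != i); have := sqr_ge0 (e.2 - p.2 : R).
    by rewrite !mxE; lra.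
  by move: le_e0; have := sum0 xpredT; rewrite /=; lra.
have [||c] := @compact_EVT_min _ R (fun c => sqdist p (point c))
    (box `&` [set c | epigraph g (point c)]) _ (compact_closedI box_compact gcl).
- by exists (coords e0); split; [exact: in_box|rewrite /= coordsK].
- exact/continuous_subspaceT/sqdist_continuous.
rewrite inE => -[_ gc] c_min; exists (point c) => // e ge.
have le_c e' : epigraph g e' -> box (coords e') -> sqdist p (point c) <= sqdist p e'.
  move=> ge' be'; rewrite -[e']coordsK; apply: c_min.
  by rewrite inE; split=> //=; rewrite coordsK.
have [/in_box|/ltW] := leP (sqdist p e) (sqdist p e0); first exact: le_c.
by apply: le_trans; apply: le_c => //; exact: in_box.
Qed.

Lemma convex_epigraph g e e' (a : R) : convex_fun g -> 0 <= a <= 1 ->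
  epigraph g e -> epigraph g e' -> epigraph g ((1 - a) *: e + a *: e').
Proof.
move=> gcv /andP[a0 a1] ge ge'.
rewrite addrC.
exact: set_mem (gcv e' e (Itv01 a0 a1) (mem_set ge') (mem_set ge)).
Qed.

(* First-order optimality of the closest point along the segment towards [e]. *)
Lemma projection_epigraph g p : closed_fun g -> convex_fun g ->
  epigraph g !=set0 ->
  exists2 q, epigraph g q & forall e, epigraph g e ->
    0 <= (dotv (q.1 - p.1) (e.1 - q.1) : R) + ((q.2 : R) - p.2) * (e.2 - q.2).
Proof.
move=> gcl gcv g0; have [q gq q_min] := closest_point_epigraph g p gcl g0.
exists q => // e ge.
apply: (@ge0_linear_of_quadratic R _ (sqdist q e)) => a /andP[a0 a1].
have a01 : 0 <= a <= 1 by rewrite (ltW a0).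
have := q_min _ (convex_epigraph g q e a gcv a01 gq ge).
rewrite /sqdist /=.
have -> : (1 - a) *: q.1 + a *: e.1 - p.1 = (q.1 - p.1) + a *: (e.1 - q.1).
  rewrite scalerBl scalerBr scale1r -!addrA; congr (_ + _).
  by rewrite [LHS]addrA [LHS]addrC; congr (_ + _); exact: addrC.
rewrite dotv_line /GRing.scale /= -subr_ge0; congr (_ <= _); ring.
Qed.

End projection.

(** * Separation, Fenchel-Moreau and the Fenchel equalities *)

Section conjugation.
Context {R : realType} {V : vectType R}.
Implicit Types (g : V -> \bar R) (p q e : V * R^o) (v : 'Hom(V, R^o)).

(** Quantifying over epigraph points replaces the possibly infinite values of [g] by real
    heights. *)
Lemma conjugate_leP g v (c : R) :
  (conjugate g v <= c%:E)%E <->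
  forall e, epigraph g e -> (v e.1 : R) - c <= (e.2 : R).
Proof.
split=> [vc e ge|vc].
  have : ((v e.1 : R)%:E - g e.1 <= c%:E)%E.
    by apply: le_trans vc; apply: ereal_sup_ubound; exists e.1.
  move: ge; rewrite /epigraph /=; case: (g e.1) => [r||] //=.
  by rewrite -EFinD !lee_fin; lra.
apply: ge_ereal_sup => _ [w _ <-].
case gw : (g w) => [r||] //=.
  have := vc (w, r); rewrite /epigraph /= gw => /(_ (lexx _)).
  by clear gw; rewrite -EFinD lee_fin; lra.
  by rewrite leNye.
(* Where [g w = -oo] every height is allowed; this one violates the bound by 1. *)
have := vc (w, (v w : R) - c - 1); rewrite /epigraph /= gw => /(_ (leNye _)).
clear gw => vwc; exfalso; suff : (1 : R) <= 0 by rewrite ler10.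
lra.
Qed.

Lemma proper_finite g : Defs.proper g ->
  exists (w : V) (r : R), g w = r%:E.
Proof.
move=> [gNy [w gw]]; exists w; exists (fine (g w)).
by rewrite fineK // fin_numE gNy lt_eqF.
Qed.

Lemma conjugate_gtNy g v : Defs.proper g -> (-oo < conjugate g v)%E.
Proof.
move=> /proper_finite[w [r gw]].
apply: (@lt_le_trans _ _ ((v w : R) - r)%:E); first exact: ltNyr.
by apply: ereal_sup_ubound; exists w => //; rewrite gw EFinB.
Qed.

Local Notation separates q p g := (forall e, epigraph g e ->
  0 <= (dotv (q.1 - p.1) (e.1 - q.1) : R) + ((q.2 : R) - p.2) * (e.2 - q.2)).

(** The hyperplane through [q] with normal [q - p] has a positive vertical component, hence is the
    graph of an affine minorant. At [p.1] its height is [q.2] plus a nonnegative multiple of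
    [dotv d d]. *)
Lemma separation_nonvertical g p q : (p.2 : R) < q.2 -> separates q p g ->
  exists v (c : R), (conjugate g v <= c%:E)%E /\ (p.2 : R) <= (v p.1 : R) - c.
Proof.
move=> pq sep; set d := q.1 - p.1 in sep.
have rt : 0 < (q.2 : R) - p.2 by rewrite subr_gt0.
pose v := - ((q.2 : R) - p.2)^-1 *: dotv d.
have vE w : (v w : R) = - ((q.2 : R) - p.2)^-1 * (dotv d w : R).
  by rewrite scale_lfunE.
exists v; exists ((v q.1 : R) - q.2); split.
  apply/conjugate_leP => e /sep; rewrite linearB /= !vE => sep_e.
  rewrite -subr_ge0 -(pmulr_rge0 _ rt).
  apply: le_trans sep_e _; rewrite le_eqVlt; apply/orP; left; apply/eqP.
  by field; rewrite gt_eqF.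
have d_ge0 : 0 <= (dotv d q.1 : R) - dotv d p.1.
  by have := dotvv_ge0 d; rewrite {2}/d linearB.
have -> : (v p.1 : R) - ((v q.1 : R) - q.2) =
    (q.2 : R) + ((dotv d q.1 : R) - dotv d p.1) / ((q.2 : R) - p.2).
  by rewrite !vE; ring.
have := divr_ge0 d_ge0 (ltW rt); lra.
Qed.

(** The point one unit above [q] is in the epigraph and isolates the vertical component of the
    normal. *)
Lemma separates_ge g p q : epigraph g q -> separates q p g ->
  (p.2 : R) <= q.2.
Proof.
move=> gq /(_ (q.1, (q.2 : R) + 1)); rewrite subrr linear0 add0r /=.
have -> : (q.2 : R) + 1 - q.2 = 1 by ring.
rewrite mulr1 subr_ge0; apply.
by rewrite /epigraph /=; apply: le_trans gq _; rewrite lee_fin lerDl.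
Qed.

(** The point projected lies one unit below the graph, over a point [w0] where [g] is finite. A
    vertical hyperplane would force [q.1 = w0], putting [q] below the graph. *)
Lemma affine_minorant g : proper_closed_convex g ->
  exists v (c : R), (conjugate g v <= c%:E)%E.
Proof.
move=> [gp gcl gcv]; have [w0 [s gw0]] := proper_finite g gp.
have ge0 : epigraph g (w0, s) by rewrite /epigraph /= gw0.
have [q gq sep] := projection_epigraph g (w0, s - 1) gcl gcv (ex_intro _ _ ge0).
have := separates_ge g _ q gq sep; rewrite le_eqVlt => /orP[/eqP /= sq|lt_sq]; last first.
  by have [v [c [vc _]]] := separation_nonvertical _ _ _ lt_sq sep; exists v, c.
have := sep _ ge0; rewrite -sq /= subrr mul0r addr0.
rewrite -[w0 - q.1]opprB linearN /= oppr_ge0 => dle0.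
have /dotvv_eq0/eqP : dotv (q.1 - w0) (q.1 - w0) = 0.
  by apply/eqP; rewrite eq_le dle0 dotvv_ge0.
rewrite subr_eq0 => /eqP qw.
by move: gq; rewrite /epigraph /= qw gw0 -sq lee_fin; lra.
Qed.

(** This is the hard half of biconjugation, [g <= g^**], phrased with affine minorants. The
    separating hyperplane can be vertical only where [g y = +oo]. *)
Lemma fenchel_moreau g (y : V) (t : R) : proper_closed_convex g ->
  (t%:E < g y)%E ->
  exists v (c : R), (conjugate g v <= c%:E)%E /\ t <= (v y : R) - c.
Proof.
move=> gpcc tgy; have [gp gcl gcv] := gpcc.
have [w0 [s gw0]] := proper_finite g gp.
have ge0 : epigraph g (w0, s) by rewrite /epigraph /= gw0.
have [q gq sep] := projection_epigraph g (y, t) gcl gcv (ex_intro _ _ ge0).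
have := separates_ge g _ q gq sep; rewrite le_eqVlt => /orP[/eqP /= tq|lt_tq]; last first.
  exact: separation_nonvertical lt_tq sep.
(* The separating hyperplane is vertical: a large multiple of its normal is
   added to some affine minorant. *)
have [v0 [c0 /conjugate_leP v0c0]] := affine_minorant g gpcc.
set d := q.1 - y in sep.
have d_gt0 : 0 < (dotv d d : R).
  rewrite lt_neqAle dotvv_ge0 andbT eq_sym; apply/eqP => /dotvv_eq0/eqP.
  rewrite subr_eq0 => /eqP qy.
  by move: gq; rewrite /epigraph /= qy -tq leNgt tgy.
(* The added term is nonpositive on the domain of [g] and equals [l * dotv d d] at [y], just enough
   to reach [t]. *)
pose l := `|t - ((v0 y : R) - c0)| / dotv d d.
have l_ge0 : 0 <= l by rewrite divr_ge0 // ltW.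
pose v := v0 - l *: dotv d.
have vE w : (v w : R) = (v0 w : R) - l * dotv d w.
  by rewrite add_lfunE opp_lfunE scale_lfunE.
exists v; exists (c0 - l * dotv d q.1); split.
  apply/conjugate_leP => e ge; rewrite vE.
  have := v0c0 _ ge; have := sep _ ge; rewrite -tq /= subrr mul0r addr0.
  rewrite linearB /= => /(mulr_ge0 l_ge0); rewrite mulrBr; lra.
have ld : l * (dotv d q.1 : R) - l * dotv d y = `|t - ((v0 y : R) - c0)|.
  by rewrite -mulrBr -[X in l * X](linearB (dotv d)) /= -/d divfK // gt_eqF.
have := ler_norm (t - ((v0 y : R) - c0)); rewrite vE; lra.
Qed.

(** By maximality of [v] and [fenchel_moreau], every real below [g y] is at most [v y - g^* v]; this
    also makes both values finite. Fenchel-Young gives the reverse inequality. *)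
Lemma fenchel_equality g (y : V) v : proper_closed_convex g -> subdiff g y v ->
  exists a b : R, [/\ g y = a%:E, conjugate g v = b%:E & a + b = v y].
Proof.
move=> gpcc vmax; have [gp _ _] := gpcc.
have below t : (t%:E < g y)%E -> (t%:E <= (v y : R)%:E - conjugate g v)%E.
  move=> /(fenchel_moreau g y t gpcc)[w [c [wc tle]]].
  apply: le_trans (vmax w); apply: le_trans (leeB (lexx _) wc).
  by rewrite -EFinB lee_fin.
have gyNy := gp.1 y.
have [t tgy] : exists t : R, (t%:E < g y)%E.
  case: (g y) gyNy => [r||] // _; last by exists 0; rewrite ltry.
  by exists (r - 1); rewrite lte_fin; lra.
have := below t tgy; have := conjugate_gtNy g v gp.
case gv : (conjugate g v) => [b||] // _ _.
have gy_le : (g y <= ((v y : R) - b)%:E)%E.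
  rewrite leNgt; apply/negP => lt_gy.
  have [u ugy ltu] : exists2 u : R, (u%:E < g y)%E & (v y : R) - b < u.
    case: (g y) lt_gy => [r||] //.
      rewrite lte_fin => lr; exists (((v y : R) - b + r) / 2).
        by rewrite lte_fin; lra.
      lra.
    by move=> _; exists ((v y : R) - b + 1); [rewrite ltry|lra].
  by have := below u ugy; rewrite gv -EFinB lee_fin leNgt ltu.
case gyE : (g y) gyNy gy_le => [a||] // _; rewrite lee_fin => ale.
exists a, b; split=> //.
have /conjugate_leP : (conjugate g v <= b%:E)%E by rewrite gv.
by move=> /(_ (y, a)); rewrite /epigraph /= gyE => /(_ (lexx _)); lra.
Qed.

(** The argmax is now over the primal space, so the supremum defining the conjugate is attained at
    [w] and no biconjugation enters. *)
Lemma fenchel_equality_conj g (w : V) v : Defs.proper g -> subdiff_conj g v w ->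
  exists a b : R, [/\ g w = a%:E, conjugate g v = b%:E & a + b = v w].
Proof.
move=> gp wmax; have [w0 [r0 gw0]] := proper_finite g gp.
have gvE : conjugate g v = ((v w : R)%:E - g w)%E.
  apply/eqP; rewrite eq_le; apply/andP; split.
    by apply: ge_ereal_sup => _ [w' _ <-]; exact: wmax.
  by apply: ereal_sup_ubound; exists w.
have := wmax w0; have := gp.1 w; rewrite gvE gw0.
case: (g w) => [a||] // _ _; exists a, ((v w : R) - a).
by split=> //; rewrite addrC subrK.
Qed.

Lemma conjugate_convex g v w (a b c : R) : 0 <= a <= 1 ->
  (conjugate g v <= b%:E)%E -> (conjugate g w <= c%:E)%E ->
  (conjugate g ((1 - a) *: v + a *: w)%R <= ((1 - a) * b + a * c)%:E)%E.
Proof.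
move=> /andP[a0 a1] /conjugate_leP vb /conjugate_leP wc.
apply/conjugate_leP => e ge; rewrite add_lfunE !scale_lfunE /GRing.scale /=.
have := vb e ge; have := wc e ge; nra.
Qed.

Lemma convex_fun_le g x y (a b c : R) : convex_fun g -> 0 <= a <= 1 ->
  (g x <= b%:E)%E -> (g y <= c%:E)%E ->
  (g ((1 - a) *: x + a *: y)%R <= ((1 - a) * b + a * c)%:E)%E.
Proof.
by move=> gcv a01 gx gy; exact: (convex_epigraph g (x, b) (y, c) a gcv a01 gx gy).
Qed.

End conjugation.

(** * The scalar inequality behind the rate *)

Lemma rate_step (R : realType) (gamma m : R) : 1 < gamma -> 0 <= m ->
  let a := gamma / (m + gamma) in
  (1 - a) * a `^ (gamma - 1) + a `^ gamma / gamma
  <= (gamma / (m + 1 + gamma)) `^ (gamma - 1).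
Proof.
move=> g1 m0 /=; set a := gamma / (m + gamma).
have g0 : 0 < gamma by lra.
have mg0 : 0 < m + gamma by lra.
have mg1 : 0 < m + 1 + gamma by lra.
have a0 : 0 <= a by rewrite divr_ge0 // ltW.
(* Dividing by [a ^ (gamma - 1)] leaves [c <= b ^ (gamma - 1)]. Using [ln t <= t - 1] at [c] and at
   [1 / b], [ln c <= c - 1 = (gamma - 1) (1 - 1 / b) <= (gamma - 1) ln b]. *)
pose b := (m + gamma) / (m + 1 + gamma); pose c := (m + 1) / (m + gamma).
have b0 : 0 < b by rewrite divr_gt0.
have c0 : 0 < c by rewrite divr_gt0 //; lra.
have -> : gamma / (m + 1 + gamma) = b * a by rewrite /a /b; field; lra.
rewrite powRM ?(ltW b0) // -(mulr_powRB1 a0 g0).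
have -> : (1 - a) * a `^ (gamma - 1) + a * a `^ (gamma - 1) / gamma
          = c * a `^ (gamma - 1).
  by rewrite mulrAC -mulrDl; congr (_ * _); rewrite /a /c; field; lra.
apply: ler_wpM2r; first exact: powR_ge0.
rewrite -ler_ln ?posrE ?powR_gt0 // ln_powR.
have ln_le (t : R) : 0 < t -> ln t <= t - 1.
  by move=> t0; rewrite -{1}[t](subrKC 1) le_ln1Dx //; lra.
have lnc := ln_le c c0.
have := ln_le b^-1; rewrite invr_gt0 => /(_ b0) lnb.
rewrite lnV ?posrE // in lnb.
have cE : c - 1 = (gamma - 1) * - (b^-1 - 1).
  by rewrite /b /c; field; lra.
apply: le_trans lnc _; rewrite cE ler_wpM2l; lra.
Qed.

(** * Curvature bound on the line search; sign of the Bregman distances *)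

Lemma adjointN (R : realType) (X Y : vectType R) (A : 'Hom(X, Y))
  (v : 'Hom(Y, R^o)) : adjoint A (- v) = - adjoint A v.
Proof. exact: comp_lfunNl. Qed.

Lemma adjointE (R : realType) (X Y : vectType R) (A : 'Hom(X, Y))
  (v : 'Hom(Y, R^o)) x : adjoint A v x = v (A x).
Proof. exact: comp_lfunE. Qed.

Lemma convex_combinationE (R : pzRingType) (V : lmodType R) (v w : V) (a : R) :
  v + a *: (w - v) = (1 - a) *: v + a *: w.
Proof. by rewrite scalerBl scale1r scalerBr -!addrA [- _ + _]addrC. Qed.

Lemma line_search_objective_le (R : realType) (X Y : vectType R)
    (A : 'Hom(X, Y)) (f : Y -> \bar R) (h : X -> \bar R)
    (df : Y -> 'Hom(Y, R^o)) (dhs : 'Hom(X, R^o) -> X) (gamma C Cs : R)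
    (H : \bar R) (x : X) (u : 'Hom(Y, R^o)) (a : R) :
  relative_curvature A f h df dhs gamma C ->
  relative_curvature_conj A f h df dhs gamma Cs ->
  dom_subdiff f (A x) -> dom_subdiff_conj h (- adjoint A u) -> 0 <= a <= 1 ->
  (line_search_objective A f h df dhs H x (dhs (- adjoint A u)%R) u (df (A x)) a
   <= (1 - a)%:E * H + ((C + Cs) * (a `^ gamma / gamma))%:E)%E.
Proof.
move=> curv curv_conj dx du a01; rewrite /line_search_objective.
rewrite [(C + Cs) * _]mulrDl !mulrA [X in (_ <= _ + X)%E]EFinD addeA; apply: leeD.
  by apply: leeD => //; exact: curv.
(* Taking [v = - u] turns the direction [- z - v] of the dual curvature into [- (z - u)], the one in
   the algorithm. *)
have := curv_conj (- u) (A x); rewrite adjointN => /(_ du dx a a01).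
suff -> : - u + a *: (- df (A x) - - u) = - (u + a *: (df (A x) - u)).
  by rewrite adjointN.
by rewrite opprD -scalerN opprB opprK [u - _]addrC.
Qed.

(** Fenchel-Young at [y] is compared with the Fenchel equality at [w]. This and its dual counterpart
    serve to show [0 <= C + Cs]. *)
Lemma bregman_oracle_ge0 (R : realType) (V : vectType R) (g : V -> \bar R)
    (dg : V -> 'Hom(V, R^o)) (y w : V) :
  proper_closed_convex g -> subdiff_oracle g dg ->
  dom_subdiff g y -> dom_subdiff g w -> (0 <= bregman g dg y w)%E.
Proof.
move=> gpcc dgP dy dw; rewrite /bregman.
have [a [_ [gy _ _]]] := fenchel_equality _ _ _ gpcc (dgP _ dy).
have [a' [b [gw gs abE]]] := fenchel_equality _ _ _ gpcc (dgP _ dw).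
have /conjugate_leP : (conjugate g (dg w) <= b%:E)%E by rewrite gs.
move=> /(_ (y, a)); rewrite /epigraph /= gy => /(_ (lexx _)).
rewrite gw -!EFinB lee_fin linearB /= -abE.
move: (dg w y : R) => c; clear; lra.
Qed.

Lemma bregman_conj_oracle_ge0 (R : realType) (V : vectType R) (g : V -> \bar R)
    (dgs : 'Hom(V, R^o) -> V) (v u : 'Hom(V, R^o)) :
  Defs.proper g -> subdiff_conj_oracle g dgs ->
  dom_subdiff_conj g v -> dom_subdiff_conj g u ->
  (0 <= bregman_conj g dgs v u)%E.
Proof.
move=> gp dgsP dv du; rewrite /bregman_conj.
have [_ [b [_ gv _]]] := fenchel_equality_conj _ _ _ gp (dgsP _ dv).
have [a [b' [gu gs abE]]] := fenchel_equality_conj _ _ _ gp (dgsP _ du).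
have /conjugate_leP : (conjugate g v <= b%:E)%E by rewrite gv.
move=> /(_ (dgs u, a)); rewrite /epigraph /= gu => /(_ (lexx _)).
rewrite gv gs -!EFinB lee_fin add_lfunE opp_lfunE -abE.
move: (v (dgs u) : R) => c; clear; lra.
Qed.

(** * Gap recursion and induction on the iterates *)

Theorem proposition8 (R : realType) (X Y : vectType R) (A : 'Hom(X, Y))
  (f : Y -> \bar R) (h : X -> \bar R)
  (f_pcc : proper_closed_convex f) (h_pcc : proper_closed_convex h)
  (df : Y -> 'Hom(Y, R^o)) (dhs : 'Hom(X, R^o) -> X)
  (df_oracle : subdiff_oracle f df) (dhs_oracle : subdiff_conj_oracle h dhs)
  (standing : oracles_compatible A f h df dhs)
  (gamma C Cs : R) (gamma_gt1 : 1 < gamma)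
  (curv : relative_curvature A f h df dhs gamma C)
  (curv_conj : relative_curvature_conj A f h df dhs gamma Cs)
  (x : nat -> X) (u : nat -> 'Hom(Y, R^o))
  (s : nat -> X) (z : nat -> 'Hom(Y, R^o))
  (alpha : nat -> R) (H : nat -> \bar R)
  (algo : primal_dual_hybrid A f h df dhs x u s z alpha)
  (alpha0 : alpha 0%N = 1)
  (bounds : line_search_bounds A f h df dhs x u s z alpha H)
  (line_search : forall k : nat, (1 <= k)%N ->
     argmin_on [set a : R | 0 <= a <= 1]
       (line_search_objective A f h df dhs (H k) (x k) (s k) (u k) (z k))
       (alpha k))
  (k : nat) (k_ge1 : (1 <= k)%N) :
  (f (A (x k)) + h (x k) + conjugate f (u k) + conjugate h (- adjoint A (u k))%R
   <= ((C + Cs) * (gamma / (k%:R + gamma)) `^ (gamma - 1))%:E)%E.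
Proof.
have [h_proper h_closed h_convex] := h_pcc.
have dx i : dom_subdiff f (A (x i)) by have [[]] := algo i.
have du i : dom_subdiff_conj h (- adjoint A (u i)) by have [[]] := algo i.
have sE i : s i = dhs (- adjoint A (u i)) by have [_ []] := algo i.
have zE i : z i = df (A (x i)) by have [_ []] := algo i.
have a01 i : 0 <= alpha i <= 1 by have [] := algo i.
have xS i : x i.+1 = (1 - alpha i) *: x i + alpha i *: s i by have [] := algo i.
have uS i : u i.+1 = (1 - alpha i) *: u i + alpha i *: z i by have [] := algo i.
pose F i : R := fine (f (A (x i))).
pose Hs i : R := fine (conjugate h (- adjoint A (u i))).
have fP i : f (A (x i)) = (F i)%:E /\
    conjugate f (z i) = ((z i (A (x i)) : R) - F i)%:E.
  have [a [b [fa fb ab]]] := fenchel_equality _ _ _ f_pcc (df_oracle _ (dx i)).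
  by rewrite /F zE fa fb /= -ab [a + b]addrC addrK.
have hP i : conjugate h (- adjoint A (u i)) = (Hs i)%:E /\
    h (s i) = (- (u i (A (s i)) : R) - Hs i)%:E.
  have [a [b [ha hb]]] := fenchel_equality_conj _ _ _ h_proper (dhs_oracle _ (du i)).
  rewrite /Hs sE ha hb /= opp_lfunE adjointE => <-.
  by rewrite addrK.
pose DF i : R := F i.+1 - F i - (z i (A (x i.+1) - A (x i)) : R).
pose DH i : R := Hs i.+1 - Hs i
  - ((- adjoint A (u i.+1) - - adjoint A (u i)) (s i) : R).
have DFE i : bregman f df (A (x i.+1)) (A (x i)) = (DF i)%:E.
  by rewrite /bregman !(fP _).1 -zE.
have DHE i : bregman_conj h dhs (- adjoint A (u i.+1)) (- adjoint A (u i))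
    = (DH i)%:E.
  by rewrite /bregman_conj !(hP _).1 -sE.
(* Real bounds [p] on [h (x i)] and [q] on [f^*] at [u i] are propagated by convexity, with
   [h (s i)] and [f^*] at [z i] rewritten by the Fenchel equalities. *)
pose p_next i (p : R) : R :=
  (1 - alpha i) * p + alpha i * (- (u i (A (s i)) : R) - Hs i).
pose q_next i (q : R) : R :=
  (1 - alpha i) * q + alpha i * ((z i (A (x i)) : R) - F i).
(* In terms of these bounds the gap recursion is an exact identity; only the convexity estimates are
   inequalities. *)
have gapS i p q : F i.+1 + Hs i.+1 + p_next i p + q_next i q =
    (1 - alpha i) * (F i + Hs i + p + q) + DF i + DH i.
  rewrite /DF /DH /p_next /q_next !(add_lfunE, opp_lfunE) !adjointE xS uS.
  rewrite !(linearB, linearD, linearZ) /= !(add_lfunE, scale_lfunE).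
  rewrite /GRing.scale /=; ring.
have [H1 HS] := bounds.
set K := C + Cs.
have x1 : x 1%N = s 0%N by rewrite xS alpha0 subrr scale0r add0r scale1r.
have u1 : u 1%N = z 0%N by rewrite uS alpha0 subrr scale0r add0r scale1r.
have H1E : H 1%N = (DF 0%N + DH 0%N)%:E by rewrite H1 -x1 -u1 DFE DHE.
have one01 : 0 <= (1 : R) <= 1 by rewrite ler01 lexx.
have H1_le : DF 0%N + DH 0%N <= K * (1 / gamma).
  (* At step size 1 the placeholder [H 1%N] has weight 0, and the rest of the objective is the pair
     of Bregman distances of the initial full step. *)
  have := line_search_objective_le _ _ _ _ _ _ _ _ _ _ _ (H 1%N) _ _ _
    curv curv_conj (dx 0%N) (du 0%N) one01.
  rewrite /line_search_objective -sE -zE !convex_combinationE subrr !scale0r.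
  rewrite !add0r !scale1r !mul0e !add0e -x1 -u1 DFE DHE powR1 -EFinD lee_fin.
  by [].
(* The sign of the constants is not assumed: [K / gamma] dominates a sum of nonnegative Bregman
   distances. *)
have K_ge0 : 0 <= K.
  have D0 : 0 <= DF 0%N + DH 0%N.
    apply: addr_ge0; rewrite -lee_fin.
      by rewrite -DFE; exact: bregman_oracle_ge0.
    by rewrite -DHE; exact: bregman_conj_oracle_ge0.
  have := le_trans D0 H1_le; rewrite mul1r pmulr_lge0 // invr_gt0; lra.
pose rate (i : nat) : R := (gamma / (i%:R + gamma)) `^ (gamma - 1).
have rateS i (a := gamma / (i%:R + gamma)) :
    (1 - a) * rate i + a `^ gamma / gamma <= rate i.+1.
  rewrite /rate -[i.+1%:R]natr1; exact: rate_step.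
(* The invariant starts at iterate 1, where all quantities are finite; [r] is the real value of
   [H]. *)
suff inv i : exists p q r : R, [/\ (h (x i.+1) <= p%:E)%E,
    (conjugate f (u i.+1) <= q%:E)%E, H i.+1 = r%:E,
    F i.+1 + Hs i.+1 + p + q <= r & r <= K * rate i.+1].
  case: k k_ge1 => // i _; have [p [q [r [hp fq _ gap_le r_le]]]] := inv i.
  rewrite (fP _).1 (hP _).1.
  apply: (@le_trans _ _ (F i.+1 + p + q + Hs i.+1)%:E).
    by rewrite !EFinD !leeD.
  by rewrite lee_fin; apply: le_trans r_le; apply: le_trans gap_le; lra.
elim: i => [|i [p [q [r [hp fq Hr gap_le r_le]]]]].
  (* [h (x 0)] and [f^* (u 0)] may be infinite; as [alpha 0 = 1] the recursion
     forgets them, so [0] serves as their bound. *)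
  exists (p_next 0%N 0), (q_next 0%N 0), (DF 0%N + DH 0%N); split=> //.
  - by rewrite x1 (hP _).2 lee_fin /p_next alpha0; lra.
  - by rewrite u1 (fP _).2 lee_fin /q_next alpha0; lra.
  - by rewrite gapS alpha0; lra.
  apply: le_trans H1_le _; apply: ler_wpM2l => //.
  (* At index 0 the comparison step is 1, so [rateS] reduces to [1 / gamma <= rate 1]. *)
  have := rateS 0%N; rewrite /= add0r divff; last by lra.
  by rewrite subrr mul0r add0r powR1.
pose r' := (1 - alpha i.+1) * r + DF i.+1 + DH i.+1.
exists (p_next i.+1 p), (q_next i.+1 q), r'; split.
- rewrite xS; apply: convex_fun_le => //; by rewrite (hP _).2.
- rewrite uS; apply: conjugate_convex => //; by rewrite (fP _).2.
- by rewrite HS // -xS -uS DFE DHE Hr -EFinM -!EFinD.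
- rewrite gapS /r' !lerD2r; apply: ler_wpM2l => //.
  by have /andP[] := a01 i.+1; lra.
set a := gamma / (i.+1%:R + gamma).
have ig : 0 < i.+1%:R + gamma by have := ler0n R i.+1; lra.
have a_01 : 0 <= a <= 1.
  rewrite divr_ge0 ?(ltW ig) //; last by lra.
  by rewrite ler_pdivrMr // mul1r lerDr ler0n.
(* [r'] is the objective at the minimizer [alpha i.+1], hence at most its value at the comparison
   step [a]. *)
have [_ /(_ a a_01)] := line_search i.+1 isT.
have := line_search_objective_le _ _ _ _ _ _ _ _ _ _ _ (H i.+1) _ _ _
  curv curv_conj (dx i.+1) (du i.+1) a_01.
rewrite -sE -zE => le_a le_alpha; have := le_trans le_alpha le_a.
rewrite {1}/line_search_objective !convex_combinationE -xS -uS DFE DHE Hr.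
rewrite -!EFinM -!EFinD lee_fin -/r' => /le_trans; apply.
apply: le_trans (ler_wpM2l K_ge0 (rateS i.+1)); rewrite -/a mulrDr lerD2r.
rewrite mulrCA; apply: ler_wpM2l => //; by have /andP[] := a_01; lra.
Qed.
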